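(* Let $p^*(c)$ be the unique BDRNE-MNL (as defined in the context) for $c\in\mathcal C$. Then $p^*(c)$ is continuous with respect to variations in $c$.
   Context: Price competition under multinomial logit demand. There are $n$ firms, firm $j$ offering product $j$ with observed characteristics $x_j\in\mathbb R^m_+$, price $p_j$ and marginal cost $c_j\in\mathcal C_j$; $c=(c_1,\dots,c_n)\in\mathcal C:=\mathcal C_1\times\cdots\times\mathcal C_n$. The vector $p_{-j}=p_{-j}(c_{-j})$ collects the prices of all firms except $j$. Consumers have preference parameters $\xi=(\beta,\alpha)$ with $\beta\in\mathbb R^m$ and $\alpha>0$; the utility of product $j$ is $U_j=\beta^Tx_j-\alpha p_j+\varepsilon_j$ and that of the outside (no-purchase) option is $U_0=\varepsilon_0$, with $\varepsilon_0,\dots,\varepsilon_n$ i.i.d. standard Gumbel. The purchase probability of product $j$ and firm $j$'s normalized profit are $$q_j(p_j,p_{-j},\xi)=\frac{e^{\beta^Tx_j-\alpha p_j}}{1+\sum_{k=1}^ne^{\beta^Tx_k-\alpha p_k}},\qquad u_j(p_j,p_{-j},c_j,\xi):=(p_j-c_j)\,q_j(p_j,p_{-j},\xi).$$ $\bar p_j(c_j,p_{-j}(c_{-j}),\xi)$ is the unique solution $p_j$ over $[c_j,+\infty)$ of $$p_j-c_j-\frac{1}{\alpha\left(\frac12-q_j(p_j,p_{-j}(c_{-j}),\xi)\right)}=0,$$ with $q_j(\bar p_j(c_j,p_{-j}(c_{-j}),\xi),p_{-j}(c_{-j}),\xi)<\frac12$. $\hat\xi:=(\underline\beta,\overline\alpha)$,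 where $\underline\beta$ is the (componentwise) lower bound of $\beta$ and $\overline\alpha$ the upper bound of $\alpha$ over the support $\Xi$ of $\xi$. Ambiguity. $\xi$ is random with values in $\Xi\subset\mathbb R^l$ ($l=m+1$). For $\theta_j\in\Theta_j\subset\mathbb R^t$, $Q_{\theta_j}$ is a nominal distribution of $\xi$ with density $f_{\theta_j}(\xi)=f(\xi|\theta_j)$. Given a prior density $\rho(\theta_j)$ and i.i.d. samples $\boldsymbol\xi^{(N_j)}=\{\xi_1,\dots,\xi_{N_j}\}$ of $\xi$, the posterior distribution of $\theta_j$ has density $\rho(\theta_j|\boldsymbol\xi^{(N_j)})=\prod_{i=1}^{N_j}f(\xi_i|\theta_j)\rho(\theta_j)\big/\int_{\Theta_j}\prod_{i=1}^{N_j}f(\xi_i|\theta)\rho(\theta)d\theta$, and $\mathbb E_{\theta_j^{N_j}}$ is expectation under it. With $\mathrm{d}_{KL}(Q\|Q_{\theta_j}):=\int_\Xi q(\xi)\ln(q(\xi)/f_{\theta_j}(\xi))d\xi$ ($q$ the density of $Q$) and radius $\epsilon_j$, $$\mathcal Q^{\theta_j}_{\epsilon_j}:=\{Q\in\mathcal M_j:\mathrm{d}_{KL}(Q\|Q_{\theta_j})\le\epsilon_j\},\qquad \mathcal M_j:=\{Q\in\mathscr P(\mathbb R^l):\mathbb E_Q[\max(\eta_j(\xi),\|\xi\|_\infty)]<\infty\},$$ where $\mathscr P(\mathbb R^l)$ is the set of probability measures on $\mathbb R^l$ and $\eta_j$ is a non-negative function with $|u_j(p_j,p_{-j},c_j,\xi)|\le\eta_j(\xi)$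 for all feasible prices and all $\xi\in\Xi$. Standing assumptions: $Q_{\theta_j}\in\mathcal M_j$ for all $\theta_j\in\Theta_j$, and $f_{\theta_j}$ is continuous in $\theta_j$. BDRNE-MNL. For fixed $c\in\mathcal C$, a BDRNE-MNL is an $n$-tuple $p^*(c)=(p_1^*(c_1),\dots,p_n^*(c_n))\in\mathcal P_1(c_1)\times\cdots\times\mathcal P_n(c_n)$ such that $$p_j^*(c_j)\in\arg\max_{p_j\in\mathcal P_j(c_j)}\mathbb E_{\theta_j^{N_j}}\Big[\min_{Q\in\mathcal Q^{\theta_j}_{\epsilon_j}}\mathbb E_Q\big[u_j(p_j,p^*_{-j}(c_{-j}),c_j,\xi)\big]\Big],\quad j=1,\dots,n,$$ where firm $j$'s action space is $\mathcal P_j(c_j):=[c_j,\bar p_j(c_j,p^*_{-j}(c_{-j}),\hat\xi)]$. *)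

(* Defs.v *)
From HB Require Import structures.
From mathcomp Require Import all_boot all_order all_algebra.
From mathcomp Require Import all_classical all_reals all_analysis.

Set Implicit Arguments.
Unset Strict Implicit.
Unset Printing Implicit Defensive.

Import Order.TTheory GRing.Theory Num.Theory.
Import numFieldNormedType.Exports.

Local Open Scope classical_set_scope.
Local Open Scope ring_scope.

(* The sigma-algebra on R^k is generated by the coordinate maps, as for
   n.-tuple in the library; it contains the open sets (open_measurable_rV) and
   is therefore the Borel sigma-algebra. *)

Definition rV_display : measure_display.
Proof. by []. Qed.

Section measurable_rV.
Context {R : realType}.
Variable k : nat.

Let coord (i : 'I_k) (v : 'rV[R]_k) : measurableTypeR R := v ord0 i.

Let rV_set0 : g_sigma_preimage coord set0.
Proof. exact: sigma_algebra0. Qed.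

Let rV_setC A : g_sigma_preimage coord A -> g_sigma_preimage coord (~` A).
Proof. exact: sigma_algebraC. Qed.

Let rV_bigcup (F : _^nat) : (forall i, g_sigma_preimage coord (F i)) ->
  g_sigma_preimage coord (\bigcup_i (F i)).
Proof. exact: sigma_algebra_bigcup. Qed.

HB.instance Definition _ := @isMeasurable.Build rV_display
  'rV[R]_k (g_sigma_preimage coord) rV_set0 rV_setC rV_bigcup.

End measurable_rV.

Section measurable_rV_lemmas.
Context {R : realType}.

Lemma measurable_coord k (i : 'I_k) :
  measurable_fun [set: 'rV[R]_k] (fun v => v ord0 i : measurableTypeR R).
Proof.
move=> _ Y mY; rewrite setTI; apply: sub_sigma_algebra => /=.
rewrite -bigcup_seq/=; exists i => /=; first by rewrite mem_index_enum.
by exists Y => //; rewrite setTI.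
Qed.

Lemma measurable_fun_rVP d (T : measurableType d) k (f : T -> 'rV[R]_k) :
  (forall i, measurable_fun [set: T] (fun t => f t ord0 i : measurableTypeR R)) ->
  measurable_fun [set: T] f.
Proof.
move=> mf _ A mA; rewrite setTI.
have : (<<s [set B : set 'rV[R]_k | measurable (f @^-1` B)] >>) A.
  move: mA; apply: sub_smallest2r; last first.
    rewrite -bigcup_seq; apply: bigcup_sub => i _ B [Y mY <-] /=.
    by rewrite setTI -comp_preimage; rewrite -[X in measurable X]setTI; exact: mf.
  exact: smallest_sigma_algebra.
rewrite sigma_algebra_id//; split => /=.
- by rewrite preimage_set0.
- by move=> B mB; rewrite setTD preimage_setC; exact: measurableC.
- by move=> F mF; rewrite preimage_bigcup; exact: bigcupT_measurable.
Qed.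

Definition rV_cons k (z : measurableTypeR R * 'rV[R]_k) : 'rV[R]_k.+1 :=
  \row_i if unlift ord0 i is Some j then z.2 ord0 j else z.1.

Definition rV_uncons k (v : 'rV[R]_k.+1) : measurableTypeR R * 'rV[R]_k :=
  (v ord0 ord0, \row_i v ord0 (lift ord0 i)).

Lemma rV_consK k : cancel (@rV_cons k) (@rV_uncons k).
Proof.
case=> a v; congr (_, _) => /=; first by rewrite mxE unlift_none.
by apply/rowP => i; rewrite !mxE liftK.
Qed.

Lemma measurable_rV_cons k : measurable_fun setT (@rV_cons k).
Proof.
apply: measurable_fun_rVP => i; rewrite /rV_cons; under eq_fun do rewrite mxE.
case: unliftP => [j _|_]; last exact: measurable_fst.
exact: (measurableT_comp (measurable_coord j) measurable_snd).
Qed.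

Lemma measurable_rV_uncons k : measurable_fun setT (@rV_uncons k).
Proof.
apply/measurable_fun_pairP; split; first exact: measurable_coord.
apply: measurable_fun_rVP => i; under eq_fun do rewrite /= mxE.
exact: measurable_coord.
Qed.

Lemma open_measurable_rV k (U : set 'rV[R]_k) : open U -> measurable U.
Proof.
move=> oU.
pose B (v : 'rV[rat]_k * rat) : set 'rV[R]_k :=
  \bigcap_(i in [set: 'I_k])
    ((fun w : 'rV[R]_k => w ord0 i : measurableTypeR R) @^-1`
      `]ratr (v.1 ord0 i) - ratr v.2, ratr (v.1 ord0 i) + ratr v.2[).
have mB v : measurable (B v).
  rewrite /B; apply: fin_bigcap_measurable; first exact: finite_finset.
  move=> i _; rewrite -[X in measurable X]setTI.
  exact: measurable_coord.
pose I := [set v | B v `<=` U].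
suff -> : U = \bigcup_(v in I) B v.
  rewrite bigcup_mkcond; apply: countable_bigcupT_measurable => [|v].
    exact: countableP.
  by case: ifP.
apply/seteqP; split => [u Uu|u [v Iv Bu]]; last exact: Iv.
have /(@nbhs_ballP R)[e /= e0 eU] : nbhs u U.
  by apply: open_nbhs_nbhs; split.
have [r [r0 re]] : exists r : rat, 0 < ratr r :> R /\ ratr r < e / 2 :> R.
  have [r] := rat_in_itvoo (divr_gt0 e0 (ltr0Sn R 1)).
  by rewrite in_itv/= => /andP h; exists r.
have q_ex (i : 'I_k) : exists q : rat,
    u ord0 i - ratr r < ratr q < u ord0 i + ratr r.
  have [|q] := @rat_in_itvoo R (u ord0 i - ratr r) (u ord0 i + ratr r).
    by rewrite ltrBlDr -addrA ltrDl addr_gt0.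
  by rewrite in_itv/= => h; exists q.
have [q qP] := choice q_ex.
have qr i : `|ratr (q i) - u ord0 i| < ratr r by rewrite ltr_distl qP.
exists (\row_i q i, r); last first.
  by move=> i _ /=; rewrite mxE in_itv/= -ltr_distlC.
move=> w Bw; apply: eU; split => // i j; rewrite (ord1 i) /ball /=.
have := Bw j Logic.I; rewrite /= mxE in_itv/= -ltr_distlC => wj.
rewrite -(subrKA (ratr (q j))) (le_lt_trans (ler_normD _ _))//.
by rewrite [e]splitr ltrD// (lt_trans _ re)// distrC.
Qed.

End measurable_rV_lemmas.

Lemma product_sigma_finite d1 d2 (T1 : measurableType d1)
    (T2 : measurableType d2) (R : realType)
    (m1 : {sigma_finite_measure set T1 -> \bar R})
    (m2 : {sigma_finite_measure set T2 -> \bar R}) :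
  sigma_finite setT (m1 \x m2)%E.
Proof.
have /sigma_finiteP[F [TF ndF Foo]] := sigma_finiteT m1.
have /sigma_finiteP[G [TG ndG Goo]] := sigma_finiteT m2.
exists (fun n => F n `*` G n).
  rewrite -setXTT TF TG predeqE => -[x y]; split.
    move=> [/= [n _ Fnx] [k _ Gky]]; exists (maxn n k) => //; split.
    - by move: x Fnx; exact/subsetPset/ndF/leq_maxl.
    - by move: y Gky; exact/subsetPset/ndG/leq_maxr.
  by move=> [n _ []/= ? ?]; split; exists n.
move=> k; have [? ?] := Foo k; have [? ?] := Goo k.
split; first exact: measurableX.
by rewrite product_measure1E// lte_mul_pinfty// ge0_fin_numE.
Qed.

Section lebesgue_rV.
Context {R : realType}.

Section cons_measure.
Context {k : nat} (mu : {sigma_finite_measure set 'rV[R]_k -> \bar R}).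

Definition cons_measure : set 'rV[R]_k.+1 -> \bar R :=
  pushforward (@lebesgue_measure R \x mu)%E (@rV_cons R k).

Let cons_measure0 : cons_measure set0 = 0%E.
Proof. by rewrite /cons_measure /pushforward preimage_set0 measure0. Qed.

Let cons_measure_ge0 A : (0 <= cons_measure A)%E.
Proof. by rewrite /cons_measure /pushforward measure_ge0. Qed.

Let cons_measure_sigma_additive : semi_sigma_additive cons_measure.
Proof.
have mcons A : measurable A -> measurable (@rV_cons R k @^-1` A).
  by move=> mA; rewrite -[X in measurable X]setTI; exact: measurable_rV_cons.
move=> F mF tF mUF; rewrite /cons_measure /pushforward preimage_bigcup.
apply: measure_semi_sigma_additive.
- by move=> n; exact: mcons.
- apply/trivIsetP => /= i j _ _ ij; rewrite -preimage_setI.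
  by move/trivIsetP : tF => /(_ _ _ _ _ ij) ->//; rewrite preimage_set0.
- by rewrite -preimage_bigcup; exact: mcons.
Qed.

HB.instance Definition _ := isMeasure.Build _ _ _ cons_measure
  cons_measure0 cons_measure_ge0 cons_measure_sigma_additive.

Let cons_sigma_finite : sigma_finite setT cons_measure.
Proof.
have [F FT Foo] := product_sigma_finite (@lebesgue_measure R) mu.
exists (fun n => @rV_uncons R k @^-1` F n); first by rewrite -preimage_bigcup -FT.
move=> i; have [mF Fi] := Foo i; split.
  by rewrite -[X in measurable X]setTI; exact: measurable_rV_uncons.
rewrite /cons_measure /pushforward -comp_preimage.
rewrite (_ : _ \o _ = idfun)//; apply/funext => z /=; exact: rV_consK.
Qed.

HB.instance Definition _ :=
  Measure_isSigmaFinite.Build _ _ _ cons_measure cons_sigma_finite.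

End cons_measure.

Fixpoint lebesgue_rV (k : nat) : {sigma_finite_measure set 'rV[R]_k -> \bar R} :=
  if k is k'.+1 then cons_measure (lebesgue_rV k')
  else dirac (0 : 'rV[R]_0).

Lemma lebesgue_rV_box k (A : 'I_k -> set (measurableTypeR R)) :
  (forall i, measurable (A i)) ->
  lebesgue_rV k [set v | forall i, A i (v ord0 i)] =
  (\prod_(i < k) lebesgue_measure (A i))%E.
Proof.
elim: k A => [|k IH] A mA /=.
  by rewrite big_ord0 diracE mem_set// => -[].
have mbox :
    measurable [set v : 'rV[R]_k | forall i, A (lift ord0 i) (v ord0 i)].
  rewrite [X in measurable X](_ : _ = \bigcap_(i in [set: 'I_k])
    ((fun w : 'rV[R]_k => w ord0 i : measurableTypeR R) @^-1` A (lift ord0 i))).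
    apply: fin_bigcap_measurable; first exact: finite_finset.
    by move=> i _; rewrite -[X in measurable X]setTI; exact: measurable_coord.
  by apply/seteqP; split => v /= vA i; [move=> _|]; exact: vA.
rewrite big_ord_recl -IH// -product_measure1E//.
rewrite /cons_measure /pushforward; congr product_measure1.
apply/seteqP; split => -[a v] /=.
  move=> h; split => [|i].
    by have := h ord0; rewrite mxE unlift_none.
  by have := h (lift ord0 i); rewrite mxE liftK.
move=> [Aa Av] i; rewrite mxE.
by case: unliftP => [j ->|->].
Qed.

End lebesgue_rV.

(* Distributions of xi are concentrated on its support Xi: [q] is the density of
   [Q] with respect to the Lebesgue measure restricted to Xi. *)
Definition has_density {R : realType} {l : nat} (Xi : set 'rV[R]_l)
    (q : 'rV[R]_l -> R) (Q : probability 'rV[R]_l R) : Prop :=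
  [/\ measurable_fun Xi q,
      forall xi, Xi xi -> 0 <= q xi &
      forall A, measurable A ->
        Q A = (\int[lebesgue_rV l]_(xi in A `&` Xi) (q xi)%:E)%E].

(* Usual conventions 0 ln (0 / b) = 0 and a ln (a / 0) = +oo for a > 0; the
   division and [ln] of the library are total and would give 0 in both cases. *)
Definition kl_integrand {R : realType} (a b : R) : \bar R :=
  if a == 0 then 0%E else if b == 0 then +oo%E else (a * ln (a / b))%:E.

Definition kl_div {R : realType} {l : nat} (Xi : set 'rV[R]_l)
    (q f : 'rV[R]_l -> R) : \bar R :=
  (\int[lebesgue_rV l]_(xi in Xi) kl_integrand (q xi) (f xi))%E.

(* A preference vector xi = (beta, alpha) is a row of length m + 1 whose last
   entry is alpha. *)
Definition pref_beta {R : realType} {m : nat} (xi : 'rV[R]_(m + 1)) : 'rV[R]_m :=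
  lsubmx xi.

Definition pref_alpha {R : realType} {m : nat} (xi : 'rV[R]_(m + 1)) : R :=
  rsubmx xi ord0 ord0.

Record mnl_market (R : realType) (n m t : nat) := MnlMarket {
  chars : 'I_n -> 'rV[R]_m;
  Xi : set 'rV[R]_(m + 1);
  Theta : 'I_n -> set 'rV[R]_t;
  nominal : 'I_n -> 'rV[R]_t -> probability 'rV[R]_(m + 1) R;
  dens : 'I_n -> 'rV[R]_t -> 'rV[R]_(m + 1) -> R;
  prior : 'I_n -> 'rV[R]_t -> R;
  nsamples : 'I_n -> nat;
  samples : forall j : 'I_n, 'I_(nsamples j) -> 'rV[R]_(m + 1);
  kl_radius : 'I_n -> R;
  envelope : 'I_n -> 'rV[R]_(m + 1) -> R
}.
Arguments samples {R n m t} _ j i.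

Section mnl_market.
Context {R : realType} {n m t : nat} (G : mnl_market R n m t).
Implicit Types (j : 'I_n) (p c : 'rV[R]_n) (xi : 'rV[R]_(m + 1)).
Implicit Types (theta : 'rV[R]_t).

(* (pj, p_{-j}): the profile [p] with its j-th entry replaced by [pj]. *)
Definition set_price j (pj : R) p : 'rV[R]_n :=
  \row_k if k == j then pj else p ord0 k.

Definition attraction p xi j : R :=
  expR ((pref_beta xi *m (chars G j)^T) ord0 ord0 - pref_alpha xi * p ord0 j).

Definition purchase_prob p xi j : R :=
  attraction p xi j / (1 + \sum_(k < n) attraction p xi k).

(* In choice_prob, profit, price_cap, action_space and objective only the
   entries of [p] other than the j-th are used. *)
Definition choice_prob j (pj : R) p xi : R :=
  purchase_prob (set_price j pj p) xi j.

Definition profit j (pj : R) p (cj : R) xi : R :=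
  (pj - cj) * choice_prob j pj p xi.

(* The requirement choice_prob < 1/2 also discards the spurious solution that
   1 / 0 = 0 would create where choice_prob = 1/2. *)
Definition price_cap j (cj : R) p xi : R :=
  xget 0 [set pj : R |
    [/\ cj <= pj,
        choice_prob j pj p xi < 2^-1 &
        pj - cj - (pref_alpha xi * (2^-1 - choice_prob j pj p xi))^-1 = 0]].

Definition xi_hat : 'rV[R]_(m + 1) :=
  row_mx (\row_(i < m) inf [set pref_beta xi ord0 i | xi in Xi G])
         (sup [set pref_alpha xi | xi in Xi G])%:M.

Definition action_space j (cj : R) p : set R :=
  `[cj, price_cap j cj p xi_hat]%classic.

Definition moment_class j : set (probability 'rV[R]_(m + 1) R) :=
  [set Q : probability 'rV[R]_(m + 1) R |
    ('E_Q[fun xi => Num.max (envelope G j xi) `|xi|]%R < +oo)%E].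

(* A distribution without density has infinite divergence. *)
Definition ambiguity_set j theta : set (probability 'rV[R]_(m + 1) R) :=
  [set Q : probability 'rV[R]_(m + 1) R | moment_class j Q /\
    exists2 d, has_density (Xi G) d Q &
      (kl_div (Xi G) d (dens G j theta) <= (kl_radius G j)%:E)%E].

(* The profit is bounded, and the infimum over the relative entropy ball is then
   a minimum. *)
Definition worst_case_profit j (pj : R) p (cj : R) theta : \bar R :=
  ereal_inf [set ('E_Q[profit j pj p cj])%E | Q in ambiguity_set j theta].

Definition likelihood j theta : R :=
  \prod_(i < nsamples G j) dens G j theta (samples G j i).

Definition evidence j : \bar R :=
  (\int[lebesgue_rV t]_(theta in Theta G j)
     (likelihood j theta * prior G j theta)%:E)%E.

Definition posterior_density j theta : R :=
  likelihood j theta * prior G j theta / fine (evidence j).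

Definition posterior_expectation j (g : 'rV[R]_t -> \bar R) : \bar R :=
  (\int[lebesgue_rV t]_(theta in Theta G j)
     (g theta * (posterior_density j theta)%:E))%E.

Definition objective j (pj : R) p (cj : R) : \bar R :=
  posterior_expectation j (worst_case_profit j pj p cj).

Definition BDRNE_MNL c p : Prop :=
  forall j,
    action_space j (c ord0 j) p (p ord0 j) /\
    forall pj, action_space j (c ord0 j) p pj ->
      (objective j pj p (c ord0 j) <= objective j (p ord0 j) p (c ord0 j))%E.

End mnl_market.

(* Main.v *)
(* The equilibrium correspondence has a closed graph and is locally bounded, so
   its unique selection is continuous.  Clearing the denominator in the equation
   for the price cap makes membership in the action space the closed condition
   [price_gap <= 1], which also bounds prices locally in [c].  For the objective,
   logit probabilities change by a factor at most [expR (2 * M * delta)] when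
   prices move by at most [delta] and [alpha <= M]; as [alpha] is bounded on
   [Xi], profits converge uniformly on [Xi], and so do their worst cases and
   posterior expectations.  The worst-case profit is never shown to be measurable
   in [theta]: the library integral of a non-negative function is a lower
   integral, which is still subadditive when one summand is measurable. *)
Require Import Defs.
From HB Require Import structures.
From mathcomp Require Import all_boot all_order all_algebra.
From mathcomp Require Import all_classical all_reals all_analysis.
From mathcomp Require Import measurable_realfun ring lra.

Import Order.TTheory GRing.Theory Num.Theory.
Import numFieldNormedType.Exports.

Local Open Scope classical_set_scope.
Local Open Scope ring_scope.

(** * Subadditivity of lower integrals, expectations and measurability *)

Section lower_integral.
Local Open Scope ereal_scope.
Import HBNNSimple.

(** For a simple function [s] below [f], the positive part [k] of [s - h] is measurable and stays
    below [g], while [s <= k + h]. Additivity is thus applied only to the measurable pair [k] and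
    [h]. *)
Lemma ge0_le_integralD (d : measure_display) (T : measurableType d)
    (R : realType) (mu : {measure set T -> \bar R}) (D : set T)
    (f g h : T -> \bar R) :
  measurable D -> measurable_fun D h ->
  (forall x, D x -> 0 <= f x) -> (forall x, D x -> 0 <= g x) ->
  (forall x, D x -> 0 <= h x) ->
  (forall x, D x -> f x <= g x + h x) ->
  \int[mu]_(x in D) f x <= \int[mu]_(x in D) g x + \int[mu]_(x in D) h x.
Proof.
move=> mD mh f0 g0 h0 fgh; rewrite (ge0_integralE _ f0).
apply: ge_ereal_sup => _ [s /= sf <-].
rewrite -integralT_nnsfun (integral_mkcond D h); set hD := h \_ D.
have hD0 x : 0 <= hD x by exact: erestrict_ge0.
have mhD : measurable_fun setT hD by exact/(measurable_restrictT _ _).1.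
have ms : measurable_fun setT (fun x => (s x)%:E) by exact/measurable_EFinP.
pose k x := maxe ((s x)%:E - hD x) 0.
have k0 x : 0 <= k x by rewrite le_max lexx orbT.
have mk : measurable_fun setT k.
  apply: measurable_maxe => //; exact: emeasurable_funB.
have skh x : (s x)%:E <= k x + hD x.
  have kNy : k x != -oo by rewrite gt_eqF// (lt_le_trans _ (k0 x)).
  move: kNy; rewrite /k; have := hD0 x; case: (hD x) => [r r0 _|_ kNy|//].
    by rewrite -leeBlDr// le_max lexx.
  by rewrite addey ?leey.
apply: (@le_trans _ _ (\int[mu]_x (k x + hD x))).
  apply: ge0_le_integral => //; first by move=> x _; rewrite lee_fin.
  exact: emeasurable_funD.
rewrite ge0_integralD// leeD2r//.
rewrite (ge0_integralE _ g0) ge0_integralTE//.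
apply: le_ereal_sup => _ [u /= uk <-]; exists u => //= x.
apply: le_trans (uk x) _; rewrite ge_max erestrict_ge0// andbT.
have := sf x; rewrite /hD !patchE; case: ifPn => xD; last by rewrite sube0.
move/le_trans => /(_ _ (fgh _ (set_mem xD))).
have := h0 _ (set_mem xD); case: (h x) => [r r0|_ _|//].
  by rewrite leeBlDr.
by rewrite addeNy leNye.
Qed.

End lower_integral.

Lemma ge0_expectation_leD (d : measure_display) (T : measurableType d)
    (R : realType) (P : probability T R) (A : set T) (X Y : T -> R) (e : R) :
  measurable A -> P (~` A) = 0%E -> (forall x, 0 <= X x) ->
  (forall x, 0 <= Y x) -> 0 <= e -> (forall x, A x -> X x <= Y x + e) ->
  ('E_P[X] <= 'E_P[Y] + e%:E)%E.
Proof.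
move=> mA PA0 X0 Y0 e0 XY; rewrite unlock.
(* The slack is infinite on the null set outside of [A], so that no
   measurability of [X] and [Y] is needed to discard this set. *)
pose h x := (e%:E + +oo * (\1_(~` A) x)%:E)%E.
have i0 x : (0 <= (\1_(~` A) x : R)%:E)%E by rewrite lee_fin indicE.
have mi : measurable_fun [set: T] (fun x => (\1_(~` A) x : R)%:E).
  by apply/measurable_EFinP; exact/measurable_indic/measurableC.
have moo : measurable_fun [set: T] (fun x => +oo * (\1_(~` A) x : R)%:E)%E.
  exact: measurable_funeM.
have <- : (\int[P]_x h x = e%:E)%E.
  rewrite ge0_integralD//.
  rewrite integral_cst// [X in (_ * X + _)%E]probability_setT mule1.
  rewrite ge0_integralZl//.
  rewrite integral_indic//; last exact: measurableC.
  by rewrite setIT [X in (_ * X)%E]PA0 mule0 adde0.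
apply: ge0_le_integralD => //.
- exact: emeasurable_funD.
- by move=> x _; rewrite lee_fin.
- by move=> x _; rewrite lee_fin.
- by move=> x _; rewrite adde_ge0// ?mule_ge0.
move=> x _; have [Ax|nAx] := pselect (A x).
  rewrite /h indicE memNset ?mule0 ?adde0; last by apply.
  by rewrite -EFinD lee_fin XY.
by rewrite /h indicE mem_set// mule1 addeA -EFinD addey ?leey.
Qed.

Lemma measurable_fun_within_continuous_rV (R : realType) (k : nat)
    (D : set 'rV[R]_k) (f : 'rV[R]_k -> R) :
  measurable D -> {within D, continuous f} -> measurable_fun D f.
Proof.
move=> mD /continuousP cf.
apply: (measurability _ (RGenOpens.measurableE R)).
move=> _ [_ [a [b ->] <-]].
have /cf/open_subspaceP[V oV VD] : open `]a, b[%classic by exact: interval_open.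
by rewrite setIC -VD; apply: measurableI => //; exact: open_measurable_rV.
Qed.

(** * Signs and bounds of logit probabilities and profits *)

Section market.
Context {R : realType} {n m t : nat} (G : mnl_market R n m t).
Implicit Types (j k : 'I_n) (p c : 'rV[R]_n) (xi : 'rV[R]_(m + 1)).

Lemma attraction_gt0 p xi j : 0 < attraction G p xi j.
Proof. exact: expR_gt0. Qed.

Lemma sum_attraction_gt0 p xi : 0 < 1 + \sum_(k < n) attraction G p xi k.
Proof.
by rewrite ltr_wpDr// sumr_ge0// => k _; rewrite ltW// attraction_gt0.
Qed.

Lemma purchase_prob_gt0 p xi j : 0 < purchase_prob G p xi j.
Proof. by rewrite divr_gt0// ?attraction_gt0// sum_attraction_gt0. Qed.

Lemma purchase_prob_le1 p xi j : purchase_prob G p xi j <= 1.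
Proof.
rewrite ler_pdivrMr ?sum_attraction_gt0// mul1r (bigD1 j)//= addrCA lerDl.
by rewrite addr_ge0// sumr_ge0// => k _; rewrite ltW// attraction_gt0.
Qed.

Lemma profit_ge0 j pj p cj xi : cj <= pj -> 0 <= profit G j pj p cj xi.
Proof. by move=> ?; rewrite mulr_ge0 ?subr_ge0// ltW// purchase_prob_gt0. Qed.

Lemma worst_case_profit_ge0 j pj p cj theta :
  cj <= pj -> (0 <= worst_case_profit G j pj p cj theta)%E.
Proof.
move=> cp; apply: le_ereal_inf_tmp => _ [Q _ <-]; rewrite unlock.
by apply: integral_ge0 => xi _; rewrite lee_fin profit_ge0.
Qed.

(** * From profit bounds on [Xi] to worst cases and posterior expectations *)

Section objective_bound.
Variables (j : 'I_n) (a a' cj cj' e : R) (p p' : 'rV[R]_n).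
Hypotheses (ca : cj <= a) (ca' : cj' <= a') (e0 : 0 <= e).
Hypothesis profitD : forall xi, Xi G xi ->
  profit G j a p cj xi <= profit G j a' p' cj' xi + e.
Hypothesis mXi : measurable (Xi G).

(** The ambiguity set depends on neither prices nor costs, so a bound valid for each of its members
    passes to the infimum. A member has a density over [Xi], hence gives the complement no mass, and
    the bound on [Xi] suffices. *)
Lemma worst_case_profit_leD theta :
  (worst_case_profit G j a p cj theta <=
   worst_case_profit G j a' p' cj' theta + e%:E)%E.
Proof.
rewrite -leeBlDr//; apply: le_ereal_inf_tmp => _ [Q amb <-].
rewrite leeBlDr//.
apply: (@le_trans _ _ ('E_Q[profit G j a p cj])%E).
  by apply: ereal_inf_lbound; exists Q.
case: amb => _ [q [_ _ Qq] _].
apply: (@ge0_expectation_leD _ _ _ _ (Xi G)) => //.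
- by rewrite Qq ?setICl ?integral_set0//; exact: measurableC.
- by move=> xi; exact: profit_ge0.
- by move=> xi; exact: profit_ge0.
Qed.

Hypothesis mTheta : measurable (Theta G j).
Hypothesis nominal_density : forall theta, Theta G j theta ->
  has_density (Xi G) (dens G j theta) (nominal G j theta).
Hypothesis dens_continuous : forall xi, Xi G xi ->
  {within Theta G j, continuous (fun theta => dens G j theta xi)}.
Hypothesis mprior : measurable_fun (Theta G j) (prior G j).
Hypothesis prior_ge0 : forall theta, Theta G j theta -> 0 <= prior G j theta.
Hypothesis samples_in_Xi : forall i, Xi G (samples G j i).
Hypothesis evidence_gt0 : (0 < evidence G j)%E.
Hypothesis evidence_lty : (evidence G j < +oo)%E.

Let weight theta := likelihood G j theta * prior G j theta.

Let weight_ge0 theta : Theta G j theta -> 0 <= weight theta.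
Proof.
move=> Tt; rewrite mulr_ge0 ?prior_ge0// prodr_ge0// => i _.
by have [_ -> //] := nominal_density _ Tt.
Qed.

Let measurable_weight : measurable_fun (Theta G j) weight.
Proof.
apply: measurable_funM => //; apply: measurable_prod => i _.
apply: measurable_fun_within_continuous_rV => //; exact: dens_continuous.
Qed.

Let inv_evidence_ge0 : 0 <= (fine (evidence G j))^-1.
Proof. by rewrite invr_ge0 fine_ge0// ltW. Qed.

Lemma posterior_density_ge0 theta :
  Theta G j theta -> 0 <= posterior_density G j theta.
Proof. by move=> Tt; rewrite mulr_ge0// weight_ge0. Qed.

Lemma measurable_posterior_density :
  measurable_fun (Theta G j) (posterior_density G j).
Proof. exact: measurable_funM. Qed.

Lemma integral_posterior_density :
  (\int[lebesgue_rV t]_(theta in Theta G j) (posterior_density G j theta)%:E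
   = 1)%E.
Proof.
under eq_integral do rewrite EFinM.
rewrite ge0_integralZr//.
- rewrite -[X in (X * _)%E]/(evidence G j).
  (* [fine] sends [+oo] to 0, so finiteness of the evidence is what makes this a genuine
     normalisation. *)
  have evE : evidence G j = (fine (evidence G j))%:E.
    by rewrite fineK// ge0_fin_numE// ltW.
  rewrite [X in (X * _)%E]evE -EFinM divff// gt_eqF// fine_gt0//.
  by rewrite evidence_gt0.
- exact/measurable_EFinP.
Qed.

(** The posterior has total mass 1, so the constant [e] is itself the integral of [e] times the
    posterior density. This is the measurable summand that [ge0_le_integralD] asks for. *)
Lemma objective_leD :
  (objective G j a p cj <= objective G j a' p' cj' + e%:E)%E.
Proof.
have mpost : measurable_fun (Theta G j)
    (fun theta => (posterior_density G j theta)%:E).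
  by apply/measurable_EFinP; exact: measurable_posterior_density.
have post0 theta :
    Theta G j theta -> (0 <= (posterior_density G j theta)%:E)%E.
  by move=> Tt; rewrite lee_fin posterior_density_ge0.
rewrite /objective /posterior_expectation -[X in (_ <= _ + X)%E]mule1.
rewrite -integral_posterior_density -ge0_integralZl//.
apply: ge0_le_integralD => //.
- exact: measurable_funeM.
- by move=> theta Tt; rewrite mule_ge0 ?worst_case_profit_ge0 ?post0.
- by move=> theta Tt; rewrite mule_ge0 ?worst_case_profit_ge0 ?post0.
- by move=> theta Tt; rewrite mule_ge0 ?post0.
move=> theta Tt; rewrite -ge0_muleDl ?worst_case_profit_ge0//.
by rewrite lee_wpmul2r ?post0// worst_case_profit_leD.
Qed.

End objective_bound.

(** * Uniform continuity of logit probabilities and profits *)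

Lemma attraction_le p p' xi k (M delta : R) :
  0 <= pref_alpha xi <= M -> `|p ord0 k - p' ord0 k| <= delta ->
  attraction G p xi k <= expR (M * delta) * attraction G p' xi k.
Proof.
move=> /andP[a0 aM] pp'; rewrite -expRD ler_expR.
suff : pref_alpha xi * (p' ord0 k - p ord0 k) <= M * delta by lra.
apply: le_trans (_ : pref_alpha xi * delta <= _).
  by rewrite ler_wpM2l// (le_trans _ pp')// distrC ler_norm.
by rewrite ler_wpM2r// (le_trans _ pp').
Qed.

(** Numerator and denominator each contribute one factor [expR (M * delta)]; the 1 of the outside
    option is absorbed because this factor is at least 1. *)
Lemma purchase_prob_le p p' xi j (M delta : R) :
  0 <= pref_alpha xi <= M -> 0 <= delta ->
  (forall k, `|p ord0 k - p' ord0 k| <= delta) ->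
  purchase_prob G p xi j <= expR (2 * M * delta) * purchase_prob G p' xi j.
Proof.
move=> aM d0 pp'; have M0 : 0 <= M by case/andP: aM => /le_trans; apply.
rewrite /purchase_prob mulrA ler_pdivlMr ?sum_attraction_gt0// mulrAC.
rewrite ler_pdivrMr ?sum_attraction_gt0//.
have -> : expR (2 * M * delta) = expR (M * delta) * expR (M * delta).
  by rewrite -expRD; congr expR; ring.
rewrite -(mulrA (expR _)) -mulrA mulrCA.
apply: ler_pM; rewrite ?(ltW (attraction_gt0 _ _ _))//.
- by rewrite ltW// sum_attraction_gt0.
- exact: attraction_le.
rewrite mulrDr mulr1 lerD//; first by rewrite -expR0 ler_expR mulr_ge0.
rewrite mulr_sumr ler_sum// => k _; apply: attraction_le => //.
by rewrite distrC.
Qed.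

Lemma dist_purchase_prob p p' xi j (M delta : R) :
  0 <= pref_alpha xi <= M -> 0 <= delta ->
  (forall k, `|p ord0 k - p' ord0 k| <= delta) ->
  `|purchase_prob G p xi j - purchase_prob G p' xi j|
    <= expR (2 * M * delta) - 1.
Proof.
move=> aM d0 pp'; have M0 : 0 <= M by case/andP: aM => /le_trans; apply.
have E0 : 0 <= expR (2 * M * delta) - 1.
  by rewrite subr_ge0 -expR0 ler_expR !mulr_ge0.
(* The hypothesis is symmetric in the two profiles, so a one-sided bound is enough; it follows from
   the multiplicative one because probabilities are at most 1. *)
have half (q q' : 'rV[R]_n) : (forall k, `|q ord0 k - q' ord0 k| <= delta) ->
    purchase_prob G q xi j - purchase_prob G q' xi j
    <= expR (2 * M * delta) - 1.
  move=> qq'; have := purchase_prob_le q q' xi j M delta aM d0 qq'.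
  have := purchase_prob_le1 q' xi j; nra.
by rewrite ler_norml lerNl opprB !half// => k; rewrite distrC.
Qed.

Section price_convergence.
Context {T : Type} {F : set_system T} {FF : Filter F}.

Lemma near_choice_prob j (a : T -> R) (a0 : R) (p : T -> 'rV[R]_n)
    (p0 : 'rV[R]_n) (M e : R) :
  a x @[x --> F] --> a0 -> (forall k, p x ord0 k @[x --> F] --> p0 ord0 k) ->
  0 < M -> 0 < e ->
  \forall x \near F, forall xi, 0 <= pref_alpha xi <= M ->
    `|choice_prob G j (a x) (p x) xi - choice_prob G j a0 p0 xi| <= e.
Proof.
(* [delta] solves [expR (2 * M * delta) - 1 = e]. It depends on [xi] only through [M], so one
   neighbourhood serves all [xi]. *)
move=> aa0 pp0 M0 e0; pose delta := ln (1 + e) / (2 * M).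
have d0 : 0 < delta by rewrite divr_gt0 ?mulr_gt0// ln_gt0// ltrDl.
have pk : \forall x \near F, forall k, `|p0 ord0 k - p x ord0 k| <= delta.
  by apply: filter_forall => k; exact: (cvgrPdist_le _ _).1 (pp0 k) _ d0.
near=> x.
have ax : `|a0 - a x| <= delta.
  by near: x; exact: (cvgrPdist_le _ _).1 aa0 _ d0.
have px : forall k, `|p0 ord0 k - p x ord0 k| <= delta by near: x.
move=> xi aM; have -> : e = expR (2 * M * delta) - 1.
  rewrite /delta mulrCA mulfV ?mulr1 ?lnK ?posrE; first by ring.
    by rewrite addr_gt0.
  by rewrite gt_eqF// mulr_gt0.
apply: dist_purchase_prob => //; first exact: ltW.
by move=> k; rewrite !mxE distrC; case: eqP.
Unshelve. all: by end_near. Qed.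

Lemma cvg_choice_prob j (a : T -> R) (a0 : R) (p : T -> 'rV[R]_n)
    (p0 : 'rV[R]_n) xi :
  a x @[x --> F] --> a0 -> (forall k, p x ord0 k @[x --> F] --> p0 ord0 k) ->
  0 <= pref_alpha xi ->
  choice_prob G j (a x) (p x) xi @[x --> F] --> choice_prob G j a0 p0 xi.
Proof.
move=> aa0 pp0 xi0; apply/cvgrPdist_le => e e0.
have M0 : 0 < pref_alpha xi + 1 by rewrite ltr_wpDl.
have := near_choice_prob j a a0 p p0 _ e aa0 pp0 M0 e0.
apply: filterS => x /(_ xi); rewrite distrC; apply.
by rewrite xi0 lerDl ler01.
Qed.

Lemma near_profit j (a cj : T -> R) (a0 cj0 : R) (p : T -> 'rV[R]_n)
    (p0 : 'rV[R]_n) (M e : R) :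
  a x @[x --> F] --> a0 -> cj x @[x --> F] --> cj0 ->
  (forall k, p x ord0 k @[x --> F] --> p0 ord0 k) -> 0 < M -> 0 < e ->
  \forall x \near F, forall xi, 0 <= pref_alpha xi <= M ->
    `|profit G j (a x) (p x) (cj x) xi - profit G j a0 p0 cj0 xi| <= e.
Proof.
move=> aa0 cc0 pp0 M0 e0.
(* The added 1 keeps [K] positive when the limit price equals the limit cost. *)
pose K := `|a0 - cj0| + 1.
have K0 : 0 < K by rewrite ltr_wpDl.
have e20 : 0 < e / 2 by rewrite divr_gt0.
have eK0 : 0 < e / 2 / K by rewrite divr_gt0.
have ac : a x - cj x @[x --> F] --> a0 - cj0 by exact: cvgB.
near=> x.
have acx : `|a0 - cj0 - (a x - cj x)| <= e / 2.
  by near: x; exact: (cvgrPdist_le _ _).1 ac _ e20.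
have qx : forall xi, 0 <= pref_alpha xi <= M ->
    `|choice_prob G j (a x) (p x) xi - choice_prob G j a0 p0 xi| <= e / 2 / K.
  by near: x; exact: near_choice_prob.
move=> xi aM; rewrite /profit; set u := a x - cj x; set u0 := a0 - cj0.
set q := choice_prob _ _ _ _ _; set q0 := choice_prob _ _ _ p0 _.
have -> : u * q - u0 * q0 = (u - u0) * q + u0 * (q - q0) by ring.
apply: (le_trans (ler_normD _ _)); rewrite [leRHS]splitr lerD//.
  rewrite normrM -[leRHS]mulr1 ler_pM//; first by rewrite distrC.
  by rewrite gtr0_norm; [exact: purchase_prob_le1|exact: purchase_prob_gt0].
have -> : e / 2 = K * (e / 2 / K) by rewrite mulrCA divff ?mulr1// gt_eqF.
rewrite normrM; rewrite ler_pM ?lerDl ?qx.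
Unshelve. all: by end_near. Qed.

End price_convergence.

(** * Dependence on the own price, and existence of the price cap *)

Local Notation utility j xi :=
  ((pref_beta xi *m (chars G j)^T) ord0 ord0).

(** The outside option and the rivals are gathered in [r], chosen before [pj]; what remains is a
    logistic function of the own price alone. *)
Lemma choice_probE j p xi : exists2 r : R, 1 <= r & forall pj,
  choice_prob G j pj p xi =
  expR (utility j xi - pref_alpha xi * pj) /
  (r + expR (utility j xi - pref_alpha xi * pj)).
Proof.
exists (1 + \sum_(k < n | k != j) attraction G p xi k).
  by rewrite lerDl sumr_ge0// => k _; rewrite ltW// attraction_gt0.
move=> pj; rewrite /choice_prob /purchase_prob (bigD1 j)//=.
rewrite [attraction G (set_price j pj p) xi j]/attraction.
rewrite [set_price _ _ _ _ _]mxE eqxx [X in 1 + X]addrC addrA.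
congr (_ / (1 + _ + _)); apply: eq_bigr => k kj.
by rewrite /attraction [set_price _ _ _ _ _]mxE (negbTE kj).
Qed.

Lemma choice_prob_anti j p xi a a' : 0 <= pref_alpha xi -> a <= a' ->
  choice_prob G j a' p xi <= choice_prob G j a p xi.
Proof.
move=> xi0 aa'; have [r r1 qE] := choice_probE j p xi; rewrite !qE.
have r0 : 0 < r by rewrite (lt_le_trans _ r1).
have A0 x : 0 < expR (utility j xi - pref_alpha xi * x) by exact: expR_gt0.
have : expR (utility j xi - pref_alpha xi * a') <=
       expR (utility j xi - pref_alpha xi * a).
  by rewrite ler_expR lerD2l lerN2 ler_wpM2l.
rewrite ler_pdivrMr ?addr_gt0// mulrAC ler_pdivlMr ?addr_gt0//.
move: (expR _) (expR _) => A A' AA'.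
suff : A' * r <= A * r by lra.
by rewrite ler_pM2r.
Qed.

Lemma choice_prob_le_quarter j p xi a : 0 < pref_alpha xi ->
  (utility j xi + 3) / pref_alpha xi <= a -> choice_prob G j a p xi <= 4^-1.
Proof.
move=> xi0; have [r r1 ->] := choice_probE j p xi.
rewrite ler_pdivrMr// mulrC => ba.
rewrite ler_pdivrMr; last by rewrite addr_gt0 ?expR_gt0// (lt_le_trans _ r1).
suff : expR (utility j xi - pref_alpha xi * a) <= 4^-1.
  by move: (expR _) => A; lra.
(* The 3 in the threshold comes from [1 + x <= expR x] at 3, which gives [4 <= expR 3]. *)
apply: (@le_trans _ _ (expR (- 3))); first by rewrite ler_expR; lra.
rewrite expRN lef_pV2 ?posrE ?expR_gt0//.
by apply: le_trans (expR_ge1Dx 3); lra.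
Qed.

(* Multiplying the equation that defines [price_cap] by its denominator turns
   [action_space] into the sublevel set [price_gap <= 1], a closed condition on
   prices and costs. *)
Definition price_gap j (pj : R) p (cj : R) xi : R :=
  pref_alpha xi * (pj - cj) * (2^-1 - choice_prob G j pj p xi).

(** Above the first entry the choice probability is at most 1/4, so the last factor of [price_gap]
    is at least 1/4; above the second the remaining product exceeds 4. *)
Definition price_bound j (cj : R) xi : R :=
  Num.max ((utility j xi + 3) / pref_alpha xi) (cj + 4 / pref_alpha xi).

Lemma price_gap_gt1 j p cj xi pj :
  0 < pref_alpha xi -> price_bound j cj xi < pj ->
  1 < price_gap j pj p cj xi.
Proof.
move=> xi0; rewrite gt_max.
move=> /andP[/ltW/(choice_prob_le_quarter _ p)-/(_ xi0) q4].
rewrite -ltrBrDl ltr_pdivrMr// /price_gap [_ * pref_alpha _]mulrC.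
by move: (pref_alpha xi * _) => x; nra.
Qed.

Lemma cvg_price_gap {T : Type} {F : set_system T} {FF : Filter F} j xi
    (a cj : T -> R) (a0 cj0 : R) (p : T -> 'rV[R]_n) (p0 : 'rV[R]_n) :
  a x @[x --> F] --> a0 -> cj x @[x --> F] --> cj0 ->
  (forall k, p x ord0 k @[x --> F] --> p0 ord0 k) -> 0 <= pref_alpha xi ->
  price_gap j (a x) (p x) (cj x) xi @[x --> F] --> price_gap j a0 p0 cj0 xi.
Proof.
move=> aa0 cc0 pp0 xi0; apply: cvgM.
  by apply: cvgM; [exact: cvg_cst|exact: cvgB].
by apply: cvgB; [exact: cvg_cst|exact: cvg_choice_prob].
Qed.

(** [xget] returns a solution once one is exhibited. The intermediate value theorem provides it:
    [price_gap] is continuous in the own price, vanishes at the cost and exceeds 1 past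
    [price_bound]. *)
Lemma price_capP j cj p xi : 0 < pref_alpha xi ->
  [/\ cj <= price_cap G j cj p xi,
      choice_prob G j (price_cap G j cj p xi) p xi < 2^-1 &
      price_gap j (price_cap G j cj p xi) p cj xi = 1].
Proof.
move=> xi0; set P := [set pj : R | [/\ cj <= pj,
  choice_prob G j pj p xi < 2^-1 &
  pj - cj - (pref_alpha xi * (2^-1 - choice_prob G j pj p xi))^-1 = 0]].
suff [x Px] : exists x, P x.
  have [cx qx] := xgetPex 0 (ex_intro _ x Px).
  rewrite -/(price_cap G j cj p xi) => xE; split => //.
  rewrite /price_gap mulrAC (subr0_eq xE) divff//.
  by rewrite mulf_neq0 ?gt_eqF// subr_gt0.
have cM : cj <= price_bound j cj xi + 1.
  by rewrite ler_wpDr// le_max lerDl divr_ge0 ?orbT// ltW.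
have gap0 : price_gap j cj p cj xi = 0 by rewrite /price_gap subrr mulr0 mul0r.
have gap1 : 1 < price_gap j (price_bound j cj xi + 1) p cj xi.
  by apply: price_gap_gt1; rewrite ?ltrDl.
have [||x xcM gapx] := @IVT R (fun a => price_gap j a p cj xi) _ _ 1 cM.
- apply: continuous_subspaceT => a; apply: cvg_price_gap.
  + exact: cvg_id.
  + exact: cvg_cst.
  + by move=> k; exact: cvg_cst.
  + exact: ltW.
- by rewrite gap0 ge_min ler01 le_max (ltW gap1) orbT.
have cx : cj <= x by move: xcM; rewrite in_itv/= => /andP[].
(* The gap is 1 and its margin factor is non-negative, so the other factor must be positive. *)
have q0 : 0 < 2^-1 - choice_prob G j x p xi.
  have : 0 <= pref_alpha xi * (x - cj) by rewrite mulr_ge0 ?subr_ge0// ltW.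
  by move: gapx; rewrite /price_gap; nra.
exists x; split => //; first by rewrite -subr_gt0.
have D0 : pref_alpha xi * (2^-1 - choice_prob G j x p xi) != 0.
  by rewrite gt_eqF// mulr_gt0.
apply/eqP; rewrite subr_eq0 -(inj_eq (mulIf D0)) mulVf//.
by rewrite mulrCA mulrA; exact/eqP.
Qed.

(** * The action space as a sublevel set of [price_gap] *)

Section equilibrium.
Hypothesis Xi_nonempty : Xi G !=set0.
Hypothesis alpha_gt0 : forall xi, Xi G xi -> 0 < pref_alpha xi.
Hypothesis alpha_bounded : has_ubound [set pref_alpha xi | xi in Xi G].

Local Notation alpha_hat := (pref_alpha (xi_hat G)).

Lemma alpha_xi_hatE : alpha_hat = sup [set pref_alpha xi | xi in Xi G].
Proof. by rewrite /pref_alpha row_mxKr mxE eqxx mulr1n. Qed.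

Lemma alpha_le_xi_hat xi : Xi G xi -> pref_alpha xi <= alpha_hat.
Proof.
by move=> Xxi; rewrite alpha_xi_hatE; apply: ub_le_sup => //; exists xi.
Qed.

Lemma alpha_xi_hat_gt0 : 0 < alpha_hat.
Proof.
by case: Xi_nonempty => xi Xxi; rewrite (lt_le_trans (alpha_gt0 _ Xxi))//;
  exact: alpha_le_xi_hat.
Qed.

(** The factor 1/2 minus the choice probability increases with the own price but may be negative
    below the cap. Both directions therefore pass through its value at the cap, which is
    positive. *)
Lemma action_spaceP j cj p pj :
  action_space G j cj p pj <->
  cj <= pj /\ price_gap j pj p cj (xi_hat G) <= 1.
Proof.
have a0 := alpha_xi_hat_gt0; have [ccap qcap gapcap] := price_capP j cj p _ a0.
rewrite /action_space /=; rewrite in_itv/=.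
set cap := price_cap _ _ _ _ _ in ccap qcap gapcap *.
have aD x : cj <= x -> 0 <= alpha_hat * (x - cj).
  by move=> cx; rewrite mulr_ge0 ?subr_ge0// ltW.
split=> [/andP[cpj pjcap]|[cpj gappj]]; first split => //.
  have qD := choice_prob_anti j p _ _ _ (ltW a0) pjcap.
  rewrite -gapcap /price_gap; apply: (@le_trans _ _ (alpha_hat * (pj - cj) *
      (2^-1 - choice_prob G j cap p (xi_hat G)))).
    by rewrite ler_wpM2l ?aD// lerD2l lerN2.
  apply: ler_wpM2r; first by rewrite subr_ge0 ltW.
  by apply: ler_wpM2l; [exact: ltW|rewrite lerD2r].
rewrite cpj/= leNgt; apply/negP => cappj.
have qD := choice_prob_anti j p _ _ _ (ltW a0) (ltW cappj).
suff : 1 < price_gap j pj p cj (xi_hat G) by rewrite ltNge gappj.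
rewrite -gapcap /price_gap; apply: (@lt_le_trans _ _ (alpha_hat * (pj - cj) *
    (2^-1 - choice_prob G j cap p (xi_hat G)))).
  by rewrite ltr_pM2r ?subr_gt0// ltr_pM2l// ltrD2r.
by rewrite ler_wpM2l ?aD// lerD2l lerN2.
Qed.

(** Shrinking the margin makes the constraint slack, so that it survives small changes of costs and
    rival prices. A lower price raises the choice probability, hence the gap shrinks at least by the
    factor [lambda]. *)
Lemma price_gap_shrink j cj p pj lambda :
  0 <= lambda < 1 -> cj <= pj -> price_gap j pj p cj (xi_hat G) <= 1 ->
  price_gap j (cj + lambda * (pj - cj)) p cj (xi_hat G) < 1.
Proof.
move=> /andP[l0 l1] cpj; have a0 := alpha_xi_hat_gt0.
have qD : choice_prob G j pj p (xi_hat G) <=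
    choice_prob G j (cj + lambda * (pj - cj)) p (xi_hat G).
  apply: choice_prob_anti; first exact: ltW.
  by rewrite -lerBrDl ler_piMl ?subr_ge0// ltW.
rewrite /price_gap addrAC subrr add0r.
have : 0 <= alpha_hat * (pj - cj) by rewrite mulr_ge0 ?subr_ge0// ltW.
rewrite (mulrCA alpha_hat); move: (alpha_hat * _) => s s0 sq1.
apply: (@le_lt_trans _ _
    (lambda * (s * (2^-1 - choice_prob G j pj p (xi_hat G))))).
  by rewrite -mulrA !ler_wpM2l// lerD2l lerN2.
have [->|l_neq0] := eqVneq lambda 0; first by rewrite mul0r.
by apply: le_lt_trans l1; rewrite ler_piMr.
Qed.

(** The bound is free of the rivals' prices, so it confines equilibrium prices even though the
    action spaces depend on them. *)
Lemma action_space_le_bound j cj p pj :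
  action_space G j cj p pj -> pj <= price_bound j cj (xi_hat G).
Proof.
move/action_spaceP => [_]; rewrite !leNgt; apply: contra => pj_gt.
exact: price_gap_gt1 alpha_xi_hat_gt0 pj_gt.
Qed.

(** * Continuity of the objective and closedness of the equilibrium graph *)

Hypothesis Xi_measurable : measurable (Xi G).
Hypothesis Theta_measurable : forall j, measurable (Theta G j).
Hypothesis nominal_density : forall j theta, Theta G j theta ->
  has_density (Xi G) (dens G j theta) (nominal G j theta).
Hypothesis dens_continuous : forall j xi, Xi G xi ->
  {within Theta G j, continuous (fun theta => dens G j theta xi)}.
Hypothesis prior_measurable : forall j,
  measurable_fun (Theta G j) (prior G j).
Hypothesis prior_ge0 : forall j theta,
  Theta G j theta -> 0 <= prior G j theta.
Hypothesis samples_in_Xi : forall j i, Xi G (samples G j i).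
Hypothesis evidence_gt0 : forall j, (0 < evidence G j)%E.
Hypothesis evidence_finite : forall j, (evidence G j < +oo)%E.

(** Two one-sided inequalities express continuity for values in the extended reals. Prices at or
    above costs keep the profits non-negative, as the integral bounds require. *)
Lemma near_objective {T : Type} {F : set_system T} {FF : Filter F} j
    (a cj : T -> R) (a0 cj0 e : R) (p : T -> 'rV[R]_n) (p0 : 'rV[R]_n) :
  a x @[x --> F] --> a0 -> cj x @[x --> F] --> cj0 ->
  (forall k, p x ord0 k @[x --> F] --> p0 ord0 k) ->
  (\forall x \near F, cj x <= a x) -> cj0 <= a0 -> 0 < e ->
  \forall x \near F,
    (objective G j (a x) (p x) (cj x) <= objective G j a0 p0 cj0 + e%:E)%E /\
    (objective G j a0 p0 cj0 <= objective G j (a x) (p x) (cj x) + e%:E)%E.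
Proof.
move=> aa0 cc0 pp0 ca ca0 e0; near=> x.
have cax : cj x <= a x by near: x.
have profitD xi : Xi G xi ->
    `|profit G j (a x) (p x) (cj x) xi - profit G j a0 p0 cj0 xi| <= e.
  move=> Xxi; have : 0 <= pref_alpha xi <= alpha_hat.
    by rewrite ltW ?alpha_gt0//= alpha_le_xi_hat.
  move: xi {Xxi}; near: x.
  by apply: near_profit => //; exact: alpha_xi_hat_gt0.
split; apply: objective_leD => //; do ?exact: ltW; do ?exact: nominal_density;
    do ?exact: dens_continuous; do ?exact: prior_ge0; move=> xi /profitD.
  by rewrite -lerBlDl; apply: le_trans; exact: ler_norm.
by rewrite -lerBlDl distrC; apply: le_trans; exact: ler_norm.
Unshelve. all: by end_near. Qed.

(** Feasibility passes to the limit because it is a closed condition. For optimality, a deviation at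
    the limit is first shrunk to have slack, then transported to nearby equilibria, where it is
    feasible and cannot be profitable. *)
Lemma closed_BDRNE :
  closed [set z : 'rV[R]_n * 'rV[R]_n | BDRNE_MNL G z.1 z.2].
Proof.
move=> [c0 p0]; rewrite closureEcvg => -[F PF [Fz FZ]] j /=.
have fstF : fst @ F --> c0.
  by apply: cvg_trans (cvg_app fst Fz) _; exact: cvg_fst.
have sndF : snd @ F --> p0.
  by apply: cvg_trans (cvg_app snd Fz) _; exact: cvg_snd.
have cF k : (fun z : 'rV[R]_n * 'rV[R]_n => z.1 ord0 k) @ F --> c0 ord0 k.
  exact: (cvg_comp _ (fun v : 'rV[R]_n => v ord0 k) fstF
    (@coord_continuous _ _ _ _ _ _)).
have pF k : (fun z : 'rV[R]_n * 'rV[R]_n => z.2 ord0 k) @ F --> p0 ord0 k.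
  exact: (cvg_comp _ (fun v : 'rV[R]_n => v ord0 k) sndF
    (@coord_continuous _ _ _ _ _ _)).
have FB : \forall z \near F, BDRNE_MNL G z.1 z.2 by apply: FZ => z.
have cvg_gap (f : 'rV[R]_n * 'rV[R]_n -> R) (x : R) : f z @[z --> F] --> x ->
    price_gap j (f z) z.2 (z.1 ord0 j) (xi_hat G) @[z --> F]
    --> price_gap j x p0 (c0 ord0 j) (xi_hat G).
  by move=> fx; apply: cvg_price_gap => //; exact: ltW alpha_xi_hat_gt0.
have c0p0 : c0 ord0 j <= p0 ord0 j.
  apply: ler_cvg_to (cF j) (pF j) _.
  by apply: filterS FB => z /(_ j)[/action_spaceP[]].
split.
  apply/action_spaceP; split=> //.
  apply: ler_cvg_to (cvg_gap _ _ (pF j)) (@cvg_cst _ _ _ _ _) _.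
  by apply: filterS FB => z /(_ j)[/action_spaceP[]].
move=> a /action_spaceP[c0a gapa]; apply/lee_addgt0Pr => e e0.
(* One third each for shrinking the deviation, moving it to a nearby equilibrium, and returning from
   that equilibrium to the limit. *)
have e30 : 0 < e / 3 by rewrite divr_gt0.
have shrink0 : l * (a - c0 ord0 j) @[l --> (1 : R)^'-] --> a - c0 ord0 j.
  rewrite -[X in _ --> X]mul1r; apply: cvgM; last exact: cvg_cst.
  exact: cvg_within.
have shrink : c0 ord0 j + l * (a - c0 ord0 j) @[l --> (1 : R)^'-] --> a.
  rewrite -[X in _ --> X](subrKC (c0 ord0 j)).
  by apply: cvgD => //; exact: cvg_cst.
have near_objl : \forall l \near (1 : R)^'-, (objective G j a p0 (c0 ord0 j) <=
    objective G j (c0 ord0 j + l * (a - c0 ord0 j)) p0 (c0 ord0 j)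
    + (e / 3)%:E)%E.
  apply: filterS (near_objective j _ _ _ _ _ _ _ shrink
    (cvg_cst (c0 ord0 j)) (fun k => cvg_cst (p0 ord0 k)) _ c0a e30)
    => [l [//]|].
  near=> l; rewrite lerDl mulr_ge0 ?subr_ge0//.
  by near: l; exact: nbhs_left_ge.
near (1 : R)^'- => l.
have l0 : 0 <= l by near: l; exact: nbhs_left_ge.
have l1 : l < 1 by near: l; exact: nbhs_left_lt.
have la0 : 0 <= l * (a - c0 ord0 j) by rewrite mulr_ge0 ?subr_ge0.
have objl : (objective G j a p0 (c0 ord0 j) <=
    objective G j (c0 ord0 j + l * (a - c0 ord0 j)) p0 (c0 ord0 j)
    + (e / 3)%:E)%E by near: l.
set al := c0 ord0 j + l * (a - c0 ord0 j) in objl.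
(* The shrunk margin is added to the cost of [z] itself, so the deviation never falls below that
   cost. *)
pose b (z : 'rV[R]_n * 'rV[R]_n) := z.1 ord0 j + l * (a - c0 ord0 j).
have bal : b z @[z --> F] --> al by apply: cvgD => //; exact: cvg_cst.
have gapl : price_gap j al p0 (c0 ord0 j) (xi_hat G) < 1.
  by apply: price_gap_shrink => //; rewrite l0.
have near_gap :
    \forall z \near F, price_gap j (b z) z.2 (z.1 ord0 j) (xi_hat G) < 1.
  exact: cvgr_lt (cvg_gap _ _ bal) _ gapl.
have near_objb : \forall z \near F, (objective G j al p0 (c0 ord0 j) <=
    objective G j (b z) z.2 (z.1 ord0 j) + (e / 3)%:E)%E.
  apply: filterS (near_objective j _ _ _ _ _ _ _ bal (cF j) pF _ _ e30)
    => [z [_ //]||]; last by rewrite lerDl.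
  by apply: nearW => z; rewrite lerDl.
have near_cp : F [set z : 'rV[R]_n * 'rV[R]_n | z.1 ord0 j <= z.2 ord0 j].
  by apply: filterS FB => z /(_ j)[/action_spaceP[]].
have near_objz : F [set z : 'rV[R]_n * 'rV[R]_n |
    (objective G j (z.2 ord0 j) z.2 (z.1 ord0 j) <=
     objective G j (p0 ord0 j) p0 (c0 ord0 j) + (e / 3)%:E)%E].
  apply: filterS (near_objective j _ _ _ _ _ _ _ (pF j) (cF j) pF near_cp
    c0p0 e30) => z [objz _].
  exact: objz.
have [z [[Bz gapz] [objb objz]]] :=
  filter_ex (filterI (filterI FB near_gap) (filterI near_objb near_objz)).
have [_ zopt] := Bz j.
have bz : (objective G j (b z) z.2 (z.1 ord0 j) <=
    objective G j (z.2 ord0 j) z.2 (z.1 ord0 j))%E.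
  by apply: zopt; apply/action_spaceP; split; [rewrite lerDl|exact: ltW].
suff chain (u v w x y : \bar R) : (u <= v + (e / 3)%:E ->
    v <= w + (e / 3)%:E -> w <= x -> x <= y + (e / 3)%:E -> u <= y + e%:E)%E.
  exact: chain objl objb bz objz.
move=> uv vw wx xy; have -> : e = e / 3 + e / 3 + e / 3 by field.
rewrite !EFinD !addeA; apply: (le_trans uv); rewrite leeD2r//.
apply: (le_trans vw); rewrite leeD2r//; exact: le_trans wx xy.
Unshelve. all: by end_near. Qed.

End equilibrium.
End market.

(** * Continuity from a closed graph with locally compact range *)

(** Push the trace on [A] of the neighbourhoods of [x] forward to the graph of [f]. A cluster point
    lies in the closed set [E] above [x], so it is [(x, f x)]; in a compact neighbourhood, a filter
    with a single cluster point converges to it. *)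
Lemma closed_graph_unique_continuous (S T : topologicalType) (A : set S)
    (E : set (S * T)) (f : S -> T) :
  hausdorff_space S -> hausdorff_space (S * T)%type -> closed E ->
  (forall x y, A x -> E (x, y) <-> y = f x) ->
  (forall x, A x -> exists U V, [/\ nbhs x U, compact U, nbhs (f x) V,
    compact V & forall y, A y -> U y -> V (f y)]) ->
  {within A, continuous f}.
Proof.
move=> hS hST cE Ef loc; apply/subspace_continuousP => x Ax.
pose W := within A (nbhs x).
have PW : ProperFilter W.
  apply: Build_ProperFilter_ex => B WB.
  by exists x; exact: (nbhs_singleton WB).
pose H := (fun y => (y, f y)) @ W.
have [U [V [xU cU fxV cV UV]]] := loc _ Ax.
have HUV : H (U `*` V).
  rewrite /H /W nbhs_simpl /within /=; apply: filterS xU => y Uy Ay.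
  by split => //; exact: UV.
have HE : H E.
  by rewrite /H /W nbhs_simpl /within /=; apply: nearW => y Ay; exact/Ef.
have Hx : fst @ H --> x by exact: cvg_within.
have clH z : cluster H z -> z = (x, f x).
  rewrite cluster_cvgE => -[K PK [Kz HK]].
  have Ez : E z.
    apply: cE; rewrite closureEcvg; exists K => //; split=> // B EB.
    exact: filterS EB (HK _ HE).
  have zx : z.1 = x.
    apply: (@cvg_unique _ hS (fst @ K)).
      by apply: cvg_trans (cvg_app fst Kz) _; exact: cvg_fst.
    by move=> B xB; apply: HK; exact: Hx.
  by case: z zx Ez {Kz} => z1 z2 /= -> /(Ef _ _ Ax) ->.
have Hlim : H --> (x, f x).
  apply: (compact_cluster_set1 hST (compact_setX cU cV)) => //.
    exists (U, V) => //.
  apply/seteqP; split=> z; first exact: clH.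
  (* Compactness supplies some cluster point, which must be [(x, f x)]. *)
  move=> ->; have [w [_ clw]] := compact_setX cU cV _ HUV.
  by rewrite -(clH _ clw).
apply: cvg_trans (cvg_app snd Hlim) _; exact: cvg_snd.
Qed.

Lemma nbhs_rV_box (R : realType) (n : nat) (l u : 'I_n -> R) (v : 'rV[R]_n) :
  (forall k, l k < v ord0 k < u k) ->
  nbhs v [set w : 'rV[R]_n | forall k, w ord0 k \in `[l k, u k]].
Proof.
move=> lvu; apply: (@filter_forall _ _
  (fun k (w : 'rV[R]_n) => w ord0 k \in `[l k, u k]) (nbhs v)) => k.
have vk : v ord0 k \in `]l k, u k[ by rewrite in_itv/=.
have ck : (fun w : 'rV[R]_n => w ord0 k) @ v --> v ord0 k.
  exact: coord_continuous.
have := ck _ (near_in_itvoo vk).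
apply: (@filterS _ (nbhs v) (nbhs_filter v)) => w.
exact: subset_itv_oo_cc.
Qed.

Theorem proposition3p5 (R : realType) (n m t : nat) (G : mnl_market R n m t)
    (C : 'I_n -> set R)
    (chars_ge0 : forall j i, 0 <= chars G j ord0 i)
    (* support of xi = (beta, alpha) *)
    (Xi_nonempty : Xi G !=set0)
    (Xi_measurable : measurable (Xi G))
    (alpha_gt0 : forall xi, Xi G xi -> 0 < pref_alpha xi)
    (beta_bounded_below : forall i : 'I_m,
      has_lbound [set pref_beta xi ord0 i | xi in Xi G])
    (alpha_bounded_above : has_ubound [set pref_alpha xi | xi in Xi G])
    (* parametric family, prior and samples *)
    (Theta_measurable : forall j, measurable (Theta G j))
    (nominal_density : forall j theta, Theta G j theta ->
      has_density (Xi G) (dens G j theta) (nominal G j theta))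
    (nominal_moment : forall j theta, Theta G j theta ->
      moment_class G j (nominal G j theta))
    (dens_continuous : forall j xi, Xi G xi ->
      {within Theta G j, continuous (fun theta => dens G j theta xi)})
    (prior_measurable : forall j, measurable_fun (Theta G j) (prior G j))
    (prior_ge0 : forall j theta, Theta G j theta -> 0 <= prior G j theta)
    (prior_integral : forall j,
      (\int[lebesgue_rV t]_(theta in Theta G j) (prior G j theta)%:E = 1)%E)
    (samples_in_Xi : forall j i, Xi G (samples G j i))
    (evidence_gt0 : forall j, (0 < evidence G j)%E)
    (evidence_finite : forall j, (evidence G j < +oo)%E)
    (* ambiguity sets *)
    (kl_radius_ge0 : forall j, 0 <= kl_radius G j)
    (envelope_measurable : forall j, measurable_fun setT (envelope G j))
    (envelope_ge0 : forall j xi, 0 <= envelope G j xi)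
    (envelope_bound : forall j (c p : 'rV[R]_n) xi,
      (forall k, C k (c ord0 k)) -> (forall k, c ord0 k <= p ord0 k) ->
      action_space G j (c ord0 j) p (p ord0 j) -> Xi G xi ->
      `|profit G j (p ord0 j) p (c ord0 j) xi| <= envelope G j xi)
    (* unique equilibrium *)
    (pstar : 'rV[R]_n -> 'rV[R]_n)
    (pstar_unique : forall c : 'rV[R]_n, (forall j, C j (c ord0 j)) ->
      BDRNE_MNL G c (pstar c) /\
      forall p, BDRNE_MNL G c p -> p = pstar c) :
  {within [set c : 'rV[R]_n | forall j, C j (c ord0 j)], continuous pstar}.
Proof.
apply: (@closed_graph_unique_continuous _ _ _
  [set z : 'rV[R]_n * 'rV[R]_n | BDRNE_MNL G z.1 z.2]).
- exact: norm_hausdorff.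
- exact: norm_hausdorff.
- exact: closed_BDRNE.
- move=> c p Cc; have [eqc uniqc] := pstar_unique c Cc.
  by split=> [/uniqc//|->].
move=> c Cc.
pose U := [set w : 'rV[R]_n |
  forall k, w ord0 k \in `[c ord0 k - 1, c ord0 k + 1]].
(* [price_bound] is nondecreasing in the cost, so the largest cost in [U] bounds the prices for all
   of [U]. *)
pose bound k := price_bound G k (c ord0 k + 1) (xi_hat G).
(* Equilibrium prices for costs in [U] lie between [c ord0 k - 1] and [bound k]; one unit of slack
   on each side makes [V] a neighbourhood of [pstar c]. *)
pose V := [set w : 'rV[R]_n |
  forall k, w ord0 k \in `[c ord0 k - 2, bound k + 1]].
have UV (y : 'rV[R]_n) : (forall j, C j (y ord0 j)) -> U y ->
    forall k, c ord0 k - 1 <= pstar y ord0 k <= bound k.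
  move=> Cy Uy k; have [eqy _] := pstar_unique y Cy.
  have [act _] := eqy k; have := Uy k; rewrite in_itv/= => /andP[cy yc].
  have yp : y ord0 k <= pstar y ord0 k.
    by case/(action_spaceP G Xi_nonempty alpha_gt0 alpha_bounded_above) : act.
  rewrite (le_trans cy yp)/=.
  apply: le_trans (action_space_le_bound G _ _ _ k _ _ _ act) _ => //.
  by rewrite /bound /price_bound ge_max !le_max lexx/= lerD2r yc orbT.
exists U, V; split.
- by apply: nbhs_rV_box => k; rewrite ltrDl ltrBlDr ltrDl ltr01.
- apply: (@rV_compact R n (fun k => `[c ord0 k - 1, c ord0 k + 1]%classic)).
  by move=> k; exact: segment_compact.
- apply: nbhs_rV_box => k; have : U c.
    by move=> i; rewrite in_itv/= lerDl lerBlDr lerDl ler01.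
  by move/(UV c Cc)/(_ k); lra.
- apply: (@rV_compact R n (fun k => `[c ord0 k - 2, bound k + 1]%classic)).
  by move=> k; exact: segment_compact.
move=> y Cy Uy k; rewrite in_itv/=; have := UV y Cy Uy k; lra.
Qed.
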